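(* Let $K$ be a field, let $A=K[x_1,\ldots,x_m]$, and let $I\subseteq A$ be any ideal such that the symbolic Rees algebra $\bigoplus_{i\geq 0}I^{(i)}$ of $I$ is a finitely generated $A$-algebra. Then there is $E\in\mathbb{N}$ such that $I^{(n)}$ is generated in degrees $\leq En$ for all $n>0$.
   Context: For an ideal $I$ of $A$, the $n$-th symbolic power is $I^{(n)}:=\bigcap_{\mathfrak p\in \mathrm{Ass}(I)}(I^nA_{\mathfrak p}\cap A)$, where $\mathrm{Ass}(I)$ denotes the set of associated primes of $A/I$, and $I^{(0)}=A$. The symbolic Rees algebra is $\bigoplus_{i\geq 0}I^{(i)}$ with multiplication $I^{(i)}\times I^{(j)}\to I^{(i+j)}$ induced from $A$. An ideal is generated in degrees $\leq d$ if it has a generating set consisting of polynomials of degree $\leq d$ (for the standard grading on $A$). *)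

(* Defs.v *)
From mathcomp Require Import all_boot all_order all_algebra.
From mathcomp Require Export fraction boolp classical_sets.
From mathcomp Require Export mpoly.

Set Implicit Arguments.
Unset Strict Implicit.
Unset Printing Implicit Defensive.

Import GRing.Theory.
Local Open Scope ring_scope.
Local Open Scope classical_set_scope.

(* The idealr structure of ring_quotient excludes the unit ideal, hence this
   definition. *)
Definition is_ideal (R : comNzRingType) (I : set R) : Prop :=
  [/\ I 0, forall x y, I x -> I y -> I (x + y) & forall a x, I x -> I (a * x)].

Definition is_prime_ideal (R : comNzRingType) (P : set R) : Prop :=
  [/\ is_ideal P, ~ P 1 & forall x y, P (x * y) -> P x \/ P y].

Definition ideal_gen (R : comNzRingType) (G : set R) : set R :=
  [set f | exists (k : nat) (a g : 'I_k -> R),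
     (forall i, G (g i)) /\ f = \sum_(i < k) a i * g i].

Definition ideal_pow (R : comNzRingType) (I : set R) (n : nat) : set R :=
  ideal_gen [set f | exists g : 'I_n -> R,
     (forall i, I (g i)) /\ f = \prod_(i < n) g i].

(* Associated primes of R / I: the primes that are the annihilator of the class
   of some a in R / I. *)
Definition ass (R : comNzRingType) (I : set R) : set (set R) :=
  [set P | is_prime_ideal P /\ exists a : R, P = [set r | I (r * a)]].

(* The localization of the domain R at a prime P, as a subset of the fraction
   field of R. *)
Definition localization (R : idomainType) (P : set R) : set {fraction R} :=
  [set x | exists a s : R, ~ P s /\ x = tofrac a / tofrac s].

(* The extension of J to the localization at P: the ideal generated there by
   the image of J. *)
Definition extension (R : idomainType) (J P : set R) : set {fraction R} :=
  [set x | exists (k : nat) (b : 'I_k -> {fraction R}) (g : 'I_k -> R),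
     [/\ forall i, localization P (b i), forall i, J (g i)
       & x = \sum_(i < k) b i * tofrac (g i)]].

Definition symbolic_power (R : idomainType) (I : set R) (n : nat) : set R :=
  if n is 0 then setT
  else \bigcap_(P in ass I) (@tofrac R @^-1` extension (ideal_pow I n) P).

(* The direct sum of the symbolic powers: a finitely supported family
   (f_i)_i with f_i in the i-th symbolic power is encoded as the polynomial
   \sum_i f_i t^i over R, so that the product induced from R is the product of
   {poly R} and the R-algebra structure map is polyC. *)
Definition symbolic_rees (R : idomainType) (I : set R) : set {poly R} :=
  [set p | forall i : nat, symbolic_power I i p`_i].

(* S is the R-subalgebra of {poly R} generated by finitely many elements g_i,
   i.e. the set of all polynomial expressions in the g_i over R. *)
Definition fin_gen_algebra (R : comNzRingType) (S : set {poly R}) : Prop :=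
  exists (k : nat) (g : 'I_k -> {poly R}), S = range (mmap (@polyC R) g).

(* msize p is the total degree of p plus one, and 0 for p = 0. *)
Definition generated_in_degrees_le (K : fieldType) (m : nat)
    (J : set {mpoly K[m]}) (d : nat) : Prop :=
  exists G : set {mpoly K[m]},
    (forall g, G g -> (msize g <= d.+1)%N) /\ J = ideal_gen G.

(* Main.v *)
Require Import Defs.
From mathcomp Require Import all_boot all_order all_algebra.

(** The symbolic Rees algebra S is a graded subring of A[t] containing A
  (a subring because it is the image of an evaluation map), and the n-th
  symbolic power consists of the c with c t^n in S; so no property of symbolic
  powers themselves is involved.  Let D bound the
  degrees of all coefficients of finitely many generators of S, and let G n be
  the set of elements of degree at most D n of the n-th symbolic power.  Then
  G a * G b is contained in G (a + b), so the polynomials whose n-th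
  coefficient lies in the ideal generated by G n, for all n, form a subring of
  A[t].  It contains A and the generators of S, hence S. *)

Set Implicit Arguments.
Unset Strict Implicit.
Unset Printing Implicit Defensive.

Import GRing.Theory.
Local Open Scope ring_scope.
Local Open Scope classical_set_scope.

Section IdealGen.
Variable R : comNzRingType.
Implicit Types (G H J L : set R).

Lemma ideal_sum J : is_ideal J -> forall (T : Type) (r : seq T) (P : pred T)
  (F : T -> R), (forall i, P i -> J (F i)) -> J (\sum_(i <- r | P i) F i).
Proof. by move=> [J0 JD _] T r P F JF; apply: big_ind. Qed.

Lemma ideal_gen_sub G : G `<=` ideal_gen G.
Proof.
move=> x Gx; exists 1%N, (fun=> 1), (fun=> x).
by split=> //; rewrite big_ord1 mul1r.
Qed.

Lemma ideal_gen_ideal G : is_ideal (ideal_gen G).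
Proof.
split=> [|x y [k [a [g [Gg ->]]]] [l [b [h [Gh ->]]]]|c x [k [a [g [Gg ->]]]]].
- by exists 0%N, (fun=> 0), (fun=> 0); split=> [[]|]; rewrite ?big_ord0.
- exists (k + l)%N,
    (fun i => match split i with inl j => a j | inr j => b j end),
    (fun i => match split i with inl j => g j | inr j => h j end).
  split=> [i|]; first by case: (split i).
  rewrite big_split_ord /=; congr (_ + _); apply: eq_bigr => i _.
    by have /= -> := unsplitK (inl i : 'I_k + 'I_l).
  by have /= -> := unsplitK (inr i : 'I_k + 'I_l).
- exists k, (fun i => c * a i), g; split=> //.
  by rewrite big_distrr; apply: eq_bigr => i _; rewrite /= mulrA.
Qed.

Lemma ideal_gen_min G J : is_ideal J -> G `<=` J -> ideal_gen G `<=` J.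
Proof.
move=> Jid GJ x [k [a [g [Gg ->]]]]; apply: ideal_sum => // i _.
by case: Jid => _ _; apply; apply: GJ.
Qed.

(** Minimality is applied twice: for fixed [y], the [z] with [z * y] in [ideal_gen L] form an ideal,
    so [x] may be taken in [G]; then likewise [y] in [H]. *)
Lemma ideal_gen_mul G H L x y : (forall g h, G g -> H h -> L (g * h)) ->
  ideal_gen G x -> ideal_gen H y -> ideal_gen L (x * y).
Proof.
move=> GHL Gx Hy; have [L0 LD LM] := ideal_gen_ideal L.
suff: ideal_gen G `<=` [set z | ideal_gen L (z * y)] by apply.
apply: ideal_gen_min => [|g Gg].
  by split=> [|u v Lu Lv|c u Lu] /=; rewrite ?mul0r ?mulrDl -?mulrA;
    [|apply: LD|apply: LM].
suff: ideal_gen H `<=` [set z | ideal_gen L (g * z)] by apply.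
apply: ideal_gen_min => [|h Hh]; last by apply: ideal_gen_sub; apply: GHL.
by split=> [|u v Lu Lv|c u Lu] /=; rewrite ?mulr0 ?mulrDr 1?mulrCA;
  [|apply: LD|apply: LM].
Qed.

End IdealGen.

Lemma coefs_msize_bound (K : fieldType) m k (g : 'I_k -> {poly {mpoly K[m]}}) :
  exists D : nat, forall i j, (msize (g i)`_j <= D)%N.
Proof.
exists (\max_(i < k) \max_(j < size (g i)) msize (g i)`_j)%N => i j.
have [jlt|jge] := ltnP j (size (g i)); last by rewrite nth_default // msize0.
apply: leq_trans (leq_bigmax i).
exact: (leq_bigmax (F := fun j : 'I_(size (g i)) => msize (g i)`_j)
  (Ordinal jlt)).
Qed.

Section SubalgebraRange.
Variables (R : comNzRingType) (k : nat) (g : 'I_k -> {poly R}).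
Let S : set {poly R} := range (mmap (@polyC R) g).

Lemma range_mmap_polyC c : S c%:P.
Proof. by exists c%:MP => //; rewrite mmapC. Qed.

Lemma range_mmap_gen i : S (g i).
Proof. by exists 'X_i => //; rewrite mmapX mmap1U. Qed.

Lemma range_mmapD p q : S p -> S q -> S (p + q).
Proof. by move=> [u _ <-] [v _ <-]; exists (u + v) => //; rewrite rmorphD. Qed.

Lemma range_mmapM p q : S p -> S q -> S (p * q).
Proof. by move=> [u _ <-] [v _ <-]; exists (u * v) => //; rewrite rmorphM. Qed.

(** Each element of the range is a sum of products of a constant and powers of the [g i]; empty sums
    and products are the constants 0 and 1. *)
Lemma range_mmap_min (T : set {poly R}) : (forall c, T c%:P) ->
  (forall i, T (g i)) -> (forall p q, T p -> T q -> T (p + q)) ->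
  (forall p q, T p -> T q -> T (p * q)) -> S `<=` T.
Proof.
move=> TC Tg TD TM _ [u _ <-]; rewrite /mmap.
apply: big_ind => [|//|mu _]; first by rewrite -polyC0.
apply: (TM _ _ (TC _)); rewrite /mmap1; apply: big_ind => [|//|i _].
  by rewrite -polyC1.
by elim: (mu i) => [|n IHn]; rewrite ?expr0 -?polyC1 // exprS; apply: TM.
Qed.

End SubalgebraRange.

Theorem mainTheorem4 (K : fieldType) (m : nat) (I : set {mpoly K[m]})
    (hI : is_ideal I) (hfg : fin_gen_algebra (symbolic_rees I)) :
  exists E : nat, forall n : nat, (0 < n)%N ->
    generated_in_degrees_le (symbolic_power I n) (E * n)%N.
Proof.
have [k [g Sg]] := hfg; have [D leD] := coefs_msize_bound g.
set F := symbolic_power I.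
have SF p : symbolic_rees I p -> forall n, F n p`_n by [].
have SC c : symbolic_rees I c%:P by rewrite Sg; apply: range_mmap_polyC.
have F0 n : F n 0 by have := SF _ (SC 0) n; rewrite coefC if_same.
have FX n c : F n c -> symbolic_rees I (c *: 'X^n).
  move=> Fc i; rewrite coefZ coefXn; case: eqP => [->|_].
    by rewrite mulr1.
  by rewrite mulr0; apply: F0.
(* Multiply the monomials [x *: 'X^a] and [y *: 'X^b] inside the Rees algebra and read off one
   coefficient. *)
have FM a b x y : F a x -> F b y -> F (a + b)%N (x * y).
  move=> /FX Sx /FX Sy.
  have /SF/(_ (a + b)%N) : symbolic_rees I (x *: 'X^a * (y *: 'X^b)).
    by move: Sx Sy; rewrite Sg; apply: range_mmapM.
  by rewrite -scalerAl -scalerAr scalerA -exprD coefZ coefXn eqxx mulr1.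
have Fid n : is_ideal (F n).
  split=> [//|x y /FX Sx /FX Sy|c x Fx].
    have /SF/(_ n) : symbolic_rees I (x *: 'X^n + y *: 'X^n).
      by move: Sx Sy; rewrite Sg; apply: range_mmapD.
    by rewrite -scalerDl coefZ coefXn eqxx mulr1.
  (* The scalar [c] lies in [F 0], which is the whole ring. *)
  exact: (FM 0%N).
pose G n := [set h | F n h /\ (msize h <= (D * n).+1)%N].
have G1 : G 0%N 1 by split; rewrite ?msize1.
have GM a b x y : G a x -> G b y -> G (a + b)%N (x * y).
  move=> [Fx dx] [Fy dy]; split; first exact: FM.
  (* [msizeM] needs nonzero factors; since [msize] is the degree plus one, it gives additivity of
     degrees. *)
  have [->|x0] := eqVneq x 0; first by rewrite mul0r msize0.
  have [->|y0] := eqVneq y 0; first by rewrite mulr0 msize0.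
  rewrite msizeM // mulnDr -subn1 leq_subLR add1n -addSn -addnS.
  exact: leq_add.
have sub : symbolic_rees I `<=` [set p | forall n, ideal_gen (G n) p`_n].
  have G0 n : ideal_gen (G n) 0 by case: (ideal_gen_ideal (G n)).
  (* In degree 0 the ideal is the unit ideal, so constant coefficients need no degree bound. *)
  have G0T c : ideal_gen (G 0%N) c.
    have [_ _ GZ] := ideal_gen_ideal (G 0%N).
    by rewrite -[c]mulr1; apply/GZ/ideal_gen_sub.
  rewrite Sg; apply: range_mmap_min => [c n|i n|p q Gp Gq n|p q Gp Gq n].
  - by rewrite coefC; case: eqP => [->|_].
  - case: n => [|n]; first exact: G0T.
    apply: ideal_gen_sub; split.
      by apply: SF; rewrite Sg; apply: range_mmap_gen.
    (* Here the index is positive, so [D] is at most [D] times the index. *)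
    by apply: leq_trans (leD i _) _; rewrite leqW // leq_pmulr.
  - by rewrite coefD; case: (ideal_gen_ideal (G n)) => _ GD _; apply: GD.
  - rewrite coefM; apply: (ideal_sum (ideal_gen_ideal _)) => i _.
    apply: ideal_gen_mul (Gp i) (Gq (n - i)%N) => x y Gx Gy.
    (* Each term of the convolution has degrees [i] and [n - i], which add up to [n]. *)
    by rewrite -(subnKC (ltn_ord i : (i <= n)%N)); apply: GM.
exists D => n _; exists (G n); split=> [h []//|].
apply/seteqP; split=> [c Fc|]; last by apply: ideal_gen_min => // h [].
(* Apply [sub] to the monomial [c *: 'X^n]. *)
by have := sub _ (FX _ _ Fc) n; rewrite coefZ coefXn eqxx mulr1.
Qed.
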